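(* Let $n$ and $k$ be integers with $3\le k\le n$. The number $f_k(n)$ of $k$-in-$n$ dissections is $$f_k(n)=\binom{2n-k-1}{n-1}.$$
   Context: Fix a convex $n$-gon ($n\ge 3$) with labelled (distinguishable) vertices; dissections are counted as distinct when their sets of diagonals differ (no identification under rotation or reflection). For $0\le m\le n-3$, an $m$-dissection of the $n$-gon is a partition of the $n$-gon into $m+1$ parts by $m$ pairwise noncrossing diagonals. A triangulation of the $n$-gon is an $(n-3)$-dissection; it has $n-2$ triangles. For $4\le k\le n$, a $k$-in-$n$ dissection is an $(n-k)$-dissection of the $n$-gon whose parts are one $k$-gon and $n-k$ triangles; when $k=4$ the one $4$-gon is the unique non-triangular part, and when $k=n$ there are no diagonals. A $3$-in-$n$ dissection is a triangulation of the $n$-gon together with a choice of one of its $n-2$ triangles (the marked triangle). $f_k(n)$ denotes the number of $k$-in-$n$ dissections. *)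

(* Defs.v *)
From mathcomp Require Import all_boot.

Set Implicit Arguments.
Unset Strict Implicit.
Unset Printing Implicit Defensive.

(* The vertices of the convex n-gon are the elements of 'I_n, in cyclic order.
   The unordered pair {i, j} is encoded by (i, j) with i < j. *)
Definition is_diagonal (n : nat) (d : 'I_n * 'I_n) : bool :=
  (d.1.+1 < d.2) && ~~ ((d.1 == 0 :> nat) && (d.2 == n.-1 :> nat)).

(* Diagonals sharing an endpoint do not cross. *)
Definition crossing (n : nat) (d e : 'I_n * 'I_n) : bool :=
  [&& d.1 < e.1, e.1 < d.2 & d.2 < e.2] || [&& e.1 < d.1, d.1 < e.2 & e.2 < d.2].

(* A dissection is identified with its set of diagonals. *)
Definition is_dissection (n m : nat) (D : {set 'I_n * 'I_n}) : bool :=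
  [&& #|D| == m,
      [forall d in D, is_diagonal d] &
      [forall d in D, forall e in D, ~~ crossing d e]].

(* A diagonal cuts the n-gon into two closed polygons, whose vertex sets both
   contain the two endpoints of the diagonal. *)
Definition side (n : nat) (b : bool) (d : 'I_n * 'I_n) : {set 'I_n} :=
  if b then [set v : 'I_n | d.1 <= v <= d.2]
  else [set v : 'I_n | (v <= d.1) || (d.2 <= v)].

(* The parts of a dissection, given by their vertex sets: a part is the
   intersection of one closed side of each diagonal (E collects the diagonals
   for which the first side is taken).  An intersection with at most two
   vertices is empty, a point or a segment, hence not a part. *)
Definition parts (n : nat) (D : {set 'I_n * 'I_n}) : {set {set 'I_n}} :=
  [set A : {set 'I_n} | (2 < #|A|) &&
    [exists E : {set 'I_n * 'I_n}, A == \bigcap_(d in D) side (d \in E) d]].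

Definition is_triangulation (n : nat) (D : {set 'I_n * 'I_n}) : bool :=
  is_dissection (n - 3) D.

Definition is_k_in_n (n k : nat) (D : {set 'I_n * 'I_n}) : bool :=
  is_dissection (n - k) D &&
  perm_eq [seq #|A| | A : {set 'I_n} in parts D] (k :: nseq (n - k) 3).

Definition is_3_in_n (n : nat) (DT : {set 'I_n * 'I_n} * {set 'I_n}) : bool :=
  [&& is_triangulation DT.1, DT.2 \in parts DT.1 & #|DT.2| == 3].

(* The number f_k(n) of k-in-n dissections, meaningful for 3 <= k <= n. *)
Definition num_k_in_n (k n : nat) : nat :=
  if k == 3 then #|[set DT | is_3_in_n (n := n) DT]|
  else #|[set D | is_k_in_n (n := n) k D]|.

(* Main.v *)
(* Let P be the k-gon of a k-in-n dissection (the marked triangle when k = 3).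
   Orient each diagonal so that P lies to one side of it, and send the
   dissection to the function counting, for each vertex, the diagonals that
   start there.  These functions are the multisets of n - k of the n vertices,
   and this is a bijection.  Going back, let h be the walk with increments
   deg - 1 along the cyclic sequence of vertices, continued periodically: there
   is a diagonal from a to b >= a + 2 exactly when h b >= h a - 1 and h > h b
   strictly between a and b.

   That the regions cut off from P are fully triangulated is a counting
   statement: the diagonal from a to b has an apex x, the last vertex before b
   that is a + 1 or joined to a, and a diagonal is determined by its apex.  So
   there are at most as many diagonals as vertices outside P, with equality
   exactly when every vertex outside P is an apex; the triangles a x b are then
   the other parts of the dissection. *)

Require Import Defs.
From mathcomp Require Import all_boot.
From mathcomp Require Import zify.

Set Implicit Arguments.
Unset Strict Implicit.
Unset Printing Implicit Defensive.

(** * Periodic arc systems *)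

(* Vertices of the n-gon are read modulo n; R a b says that there is a diagonal
   from a to b with the k-gon avoiding the vertices strictly between a and b. *)
Record arc_system (n : nat) (R : rel nat) : Prop := ArcSystem {
  arc_gap : forall a b, R a b -> a.+1 < b < a + n;
  arc_per : forall a b, R (a + n) (b + n) = R a b;
  arc_lam : forall a b c d, R a b -> R c d -> a < c < b -> d <= b;
  arc_asym : forall a b, R a b -> ~~ R b (a + n) }.

Definition apex (R : rel nat) (a b x : nat) : Prop :=
  [/\ R a b, a < x < b, (x == a.+1) || R a x
    & forall y, x < y < b -> ~~ R a y].

Definition covered (R : rel nat) (x : nat) : Prop :=
  exists a b, R a b /\ a < x < b.

(* Indices are natural numbers: n <= x leaves room below x for the start of any
   arc over x. *)
Definition perfect (n : nat) (R : rel nat) : Prop :=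
  forall x, n <= x -> covered R x -> exists a b, apex R a b x.

Definition outdeg (n : nat) (R : rel nat) (a : nat) : nat :=
  \sum_(a <= b < a + n) R a b.

Section ArcSystem.

Variables (n : nat) (R : rel nat).
Hypothesis sysR : arc_system n R.

Lemma arc_perM q a b : R (a + q * n) (b + q * n) = R a b.
Proof.
elim: q => [|q IH]; first by rewrite !addn0.
by rewrite mulSnr !addnA (arc_per sysR).
Qed.

Lemma apex_exists a b : R a b -> exists x, apex R a b x.
Proof.
move=> Rab; have gab := arc_gap sysR Rab.
pose P x := (a < x < b) && ((x == a.+1) || R a x).
have exP : exists x, P x by exists a.+1; rewrite /P eqxx andbT; lia.
have ubP x : P x -> x <= b by rewrite /P; lia.
case: (ex_maxnP exP ubP) => x /andP[xab xR] xmax.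
exists x; split=> // y xyb; apply/negP => Ray.
have : P y by rewrite /P Ray orbT andbT; lia.
by move/xmax; lia.
Qed.

(** If one arc started strictly between [a] and [x] and passed over [x], it would break laminarity
    with the arc from [a] to [x]; so the starts agree. The shorter of two distinct arcs from [a]
    would then end at a vertex after [x] joined to [a], against maximality of the apex. *)
Lemma apex_inj a b c d x : apex R a b x -> apex R c d x -> a = c /\ b = d.
Proof.
have main a1 b1 c1 d1 : apex R a1 b1 x -> apex R c1 d1 x -> a1 <= c1 -> a1 = c1.
  case=> R1 x1 /orP e1 m1 [R2 x2 e2 m2] le.
  case: (ltnP a1 c1) => [lt|]; last by lia.
  case: e1 => [|Rax]; first lia.
  have : a1 < c1 < x by lia.
  by move/(arc_lam sysR Rax R2); lia.
move=> A1 A2.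
have eac : a = c.
  case: (leqP a c) => [/(main _ _ _ _ A1 A2)//|/ltnW/(main _ _ _ _ A2 A1)//].
subst c; split=> //.
case: A1 A2 => R1 x1 e1 m1 [R2 x2 e2 m2].
case: (ltngtP b d) => // lt.
- by have := m2 b; rewrite R1; lia.
- by have := m1 d; rewrite R2; lia.
Qed.

Lemma apex_per q a b x :
  apex R a b x -> apex R (a + q * n) (b + q * n) (x + q * n).
Proof.
case=> R1 x1 e1 m1; split.
- by rewrite arc_perM.
- lia.
- by rewrite -addSn eqn_add2r arc_perM.
- move=> y xy; have -> : y = (y - q * n) + q * n by lia.
  rewrite arc_perM; apply: m1; lia.
Qed.

(** Let [c] be the first vertex after [a] that is [b - 1] or joined to [b]. If [c < x], the arc from
    [c] to [b] crosses the one from [a] to [x]. If [x < c], then [c] is the apex of an arc from some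
    [e]; the cases [e < a], [e > a], [e = a] contradict laminarity, minimality of [c] and maximality
    of [x] respectively. *)
Lemma perfect_triangle a b x :
  perfect n R -> apex R a b x -> x.+1 = b \/ R x b.
Proof.
(* Adding a period puts all vertices involved in the range where [perfect] applies. *)
move=> perfR; wlog na : a b x / n <= a.
  move=> main /(apex_per 1)/main; rewrite -addSn arc_perM mul1n => main0.
  case: main0; first by lia.
    by move=> ?; left; lia.
  by right.
move=> [Rab xab ex mx]; have gab := arc_gap sysR Rab.
pose P c := (a < c < b) && ((c.+1 == b) || R c b).
have exP : exists c, P c by exists b.-1; rewrite /P; apply/andP; split; lia.
case: (ex_minnP exP) => c /andP[cab /orP cR] cmin.
case: (ltngtP c x) => [cx|xc|ecx].
- case: cR => [|Rcb]; first lia.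
  case/orP: ex => [|Rax]; first lia.
  by have := arc_lam sysR Rax Rcb; lia.
- have cov : covered R c by exists a, b.
  have [|e [f [Ref cef ec mc]]] := perfR c _ cov; first lia.
  case: (ltngtP e a) => [ea|ae|eea].
  + case/orP: ec => [|Rec]; first lia.
    by have := arc_lam sysR Rec Rab; lia.
  + have fb : f <= b by apply: (arc_lam sysR Rab Ref); lia.
    have ef : f = b.
      case: cR => [|Rcb]; first lia.
      by have := arc_lam sysR Ref Rcb cef; lia.
    have : P e by rewrite /P -ef Ref orbT; lia.
    by move/cmin; lia.
  + subst e; case/orP: ec => [|Rac]; first lia.
    by have := mx c; rewrite Rac; lia.
- by rewrite -ecx; case: cR => [/eqP|]; [left|right].
Qed.

Lemma outdeg_per a : outdeg n R (a + n) = outdeg n R a.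
Proof.
rewrite /outdeg big_addn addnK.
by apply: eq_bigr => b _; rewrite (arc_per sysR).
Qed.

End ArcSystem.

(** * The walk of a degree sequence *)

Lemma sum_nat_unique m n (P : pred nat) x :
  m <= x < n -> P x -> (forall y, m <= y < n -> P y -> y = x) ->
  \sum_(m <= y < n) P y = 1.
Proof.
move=> xmn Px uniqx; rewrite (bigD1_seq x) ?mem_index_iota ?iota_uniq //= Px.
rewrite big_seq_cond big1 // => y; rewrite mem_index_iota => /andP[ymn yx].
by case Py: (P y) => //; rewrite (uniqx y) ?eqxx in yx.
Qed.

Lemma sum_nat_pred0 m n (P : pred nat) :
  (forall y, m <= y < n -> ~~ P y) -> \sum_(m <= y < n) P y = 0.
Proof.
move=> nP; rewrite big_nat_cond big1 // => y /andP[/nP].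
by case: (P y).
Qed.

Section Walk.

Variable g : nat -> nat.

Definition psum i := \sum_(0 <= j < i) g j.

Lemma psumS i : psum i.+1 = psum i + g i.
Proof. by rewrite /psum big_nat_recr. Qed.

(* With h i = psum i - i, this says h b >= h a - 1 and h c > h b for all c
   strictly between a and b; the inequalities are rearranged to avoid
   truncated subtraction. *)
Definition walk_arc : rel nat := fun a b =>
  [&& a.+1 < b, psum a + b <= psum b + a.+1
    & all (fun c => psum b + c < psum c + b) (iota a.+1 (b - a.+1))].

Lemma walk_arcP a b :
  reflect [/\ a.+1 < b, psum a + b <= psum b + a.+1
             & forall c, a < c < b -> psum b + c < psum c + b]
          (walk_arc a b).
Proof.
apply: (iffP and3P) => -[ab hab rec]; split=> //.
  by move=> c cab; apply: (allP rec); rewrite mem_iota; lia.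
by apply/allP => c; rewrite mem_iota => cab; apply: rec; lia.
Qed.

Variables n k : nat.
Hypotheses (g_per : forall i, g (i + n) = g i) (k_gt2 : 2 < k).
Hypothesis sum_g : \sum_(0 <= i < n) g i + k = n.

Lemma psum_per i : psum (i + n) = psum i + psum n.
Proof.
elim: i => [|i IH]; first by rewrite add0n /psum [in RHS]big_geq.
by rewrite addSn !psumS IH g_per addnAC.
Qed.

Lemma psum_perM i q : psum (i + q * n) = psum i + q * psum n.
Proof.
elim: q => [|q IH]; first by rewrite !addn0.
by rewrite !mulSnr !addnA psum_per IH.
Qed.

(** The walk [h] loses [k] in each period and at most one in each step, so it reaches every lower
    level exactly; [b] is its first visit to [h a - e]. *)
Lemma first_drop a e : 0 < e -> exists b,
  [/\ a < b, psum b + a + e = psum a + b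
    & forall c, a <= c < b -> psum a + c < psum c + a + e].
Proof.
move=> e0; pose P b := (a < b) && (psum b + a + e <= psum a + b).
have psn : psum n + k = n by [].
(* After [e] periods the walk has lost [e * k], which is at least [e]. *)
have exP : exists b, P b by exists (a + e * n); rewrite /P psum_perM; nia.
case: (ex_minnP exP) => b /andP[ab hb] bmin.
have rec c : a <= c < b -> psum a + c < psum c + a + e.
  move=> cab; case: (ltngtP a c) => [ac||<-]; try lia.
  by rewrite ltnNge; apply/negP => hc; have := bmin c; rewrite /P ac; lia.
exists b; split=> //.
case: b ab hb {bmin} rec => // b ab hb rec.
have := rec b; rewrite psumS in hb *; lia.
Qed.

(** An arc loses at most one level, whereas a period loses [k > 2]: this bounds the length of an
    arc, and excludes two arcs that together go once around. For [a < c < b < d], the two arcs would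
    give [h c > h b > h d >= h c - 1]. *)
Lemma walk_arc_system : arc_system n walk_arc.
Proof.
have psn : psum n + k = n by [].
split.
- move=> a b /walk_arcP[ab hab rec]; rewrite ab /= ltnNge; apply/negP => anb.
  have pan := psum_per a.
  have [eb|lb] := eqVneq b (a + n); first by subst b; lia.
  have := rec (a + n); lia.
- move=> a b; apply/esym.
  apply/walk_arcP/walk_arcP; rewrite !psum_per => -[ab hab rec]; split; try lia.
    move=> c cab; have := rec (c - n); have := psum_per (c - n).
    by rewrite subnK; lia.
  by move=> c cab; have := rec (c + n); rewrite psum_per; lia.
- move=> a b c d /walk_arcP[ab hab rab] /walk_arcP[cd hcd rcd] cab.
  rewrite leqNgt; apply/negP => bd.
  have := rab c; have := rcd b; lia.
- move=> a b /walk_arcP[ab hab rab]; apply/negP => /walk_arcP[ba hba rba].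
  have := psum_per a; lia.
Qed.

(** The arc with apex [x] starts at the last [a < x] with [h a <= h x], which exists because [x] is
    covered, and ends at the first [b > x] with [h b = h x - 1]. *)
Lemma walk_arc_perfect : perfect n walk_arc.
Proof.
move=> x _ [a0 [b0 [/walk_arcP[ab0 hab0 rab0] x0]]].
pose P a := (a < x) && (psum a + x <= psum x + a).
have exP : exists a, P a by exists a0; rewrite /P; have := rab0 x; lia.
have ubP a : P a -> a <= x by rewrite /P; lia.
case: (ex_maxnP exP ubP) => a /andP[ax hax] amax {ubP}.
have ra c : a < c < x -> psum x + c < psum c + x.
  move=> cax; rewrite ltnNge; apply/negP => hc.
  by have := amax c; rewrite /P; lia.
have [b [xb hb rb]] := @first_drop x 1 isT.
exists a, b; split.
- apply/walk_arcP; split; try lia.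
  move=> c cab; have := ra c; have := rb c; case: (ltngtP c x); lia.
- lia.
- case: (ltngtP x a.+1) => //; first lia.
  by move=> xa; apply/walk_arcP; split=> //; lia.
- move=> y xyb; apply/negP => /walk_arcP[_ _ ry].
  have := ry x; have := rb y; lia.
Qed.

(** The arcs from [a] end at the first visits, after [a + 1], to the levels [h (a + 1) - e] with
    [1 <= e <= g a], because [h (a + 1) = h a + g a - 1]. Exchanging sums counts one arc for each
    level. *)
Lemma outdeg_walk_arc a : outdeg n walk_arc a = g a.
Proof.
pose lev b e := psum b + a.+1 + e == psum a.+1 + b.
have lev_sum b : walk_arc a b =
    \sum_(1 <= e < (g a).+1) (walk_arc a b && lev b e) :> nat.
  case: walk_arcP => [[ab hab rab]|_] /=; last by rewrite big1.
  have pa := psumS a; have ra := rab a.+1.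
  rewrite (@sum_nat_unique _ _ _ (psum a.+1 + b - psum b - a.+1)) /lev //; lia.
rewrite /outdeg (eq_bigr _ (fun b _ => lev_sum b)) exchange_big /=.
rewrite big_nat (eq_bigr (fun=> 1)) => [|e eg]; last first.
  have [|b [ab hb rb]] := @first_drop a.+1 e; first lia.
  have Wab : walk_arc a b.
    have pa := psumS a.
    apply/walk_arcP; split; try lia; last by move=> c cab; have := rb c; lia.
  rewrite (@sum_nat_unique _ _ _ b) //.
  - by have := arc_gap walk_arc_system Wab; lia.
  - by rewrite Wab /lev; lia.
  move=> y _ /andP[/walk_arcP[ay hay ry] /eqP ly].
  case: (ltngtP y b) => // yb; first by have := rb y; lia.
  by have := ry b; lia.
by rewrite -big_nat sum_nat_const_nat; lia.
Qed.

End Walk.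

(** * Recovering a perfect arc system from its out-degrees *)

Section Reconstruction.

Variables (n k : nat) (R : rel nat).
Hypotheses (sysR : arc_system n R) (perfR : perfect n R) (k_gt2 : 2 < k).
Hypothesis sum_outdeg : \sum_(0 <= i < n) outdeg n R i + k = n.

Local Notation g := (outdeg n R).

Lemma outdeg_inner a b x :
  R a b -> a < x < b -> outdeg n R x = \sum_(x <= y < b.+1) R x y.
Proof.
move=> Rab xab; have gab := arc_gap sysR Rab.
rewrite /outdeg (@big_cat_nat _ _ _ b.+1) /=; try lia.
rewrite [X in _ + X]sum_nat_pred0 ?addn0 // => y yb; apply/negP => Rxy.
by have := arc_lam sysR Rab Rxy; lia.
Qed.

Lemma sum_out_apex a b x : apex R a b x ->
  \sum_(a <= y < b.+1) R a y = (\sum_(a <= y < x.+1) R a y).+1.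
Proof.
case=> Rab xab _ mx; rewrite (@big_cat_nat _ _ _ x.+1) /=; try lia.
rewrite (@sum_nat_unique x.+1 _ _ b) ?addn1 //; first lia.
move=> y yxb Ray; have := mx y; rewrite Ray; lia.
Qed.

(** From [a + 1] to [b] the walk falls by the number of arcs from [a] ending by [b]. The induction
    on length splits at the apex [x]: all arcs from [x] end by [b], so the stretch from [x] to [b]
    falls by exactly one, which accounts for the arc from [a] to [b] itself. *)
Lemma arc_psum a b : R a b ->
  psum g b + a.+1 + \sum_(a <= y < b.+1) R a y = psum g a.+1 + b /\
  (forall c, a < c < b -> psum g b + c < psum g c + b).
Proof.
have [m] := ubnP (b - a); elim: m a b => // m IH a b bam Rab.
have [x ap] := apex_exists sysR Rab.
have [_ xab ex mx] := ap.
have [hx rx] : psum g x + a.+1 + \sum_(a <= y < x.+1) R a y = psum g a.+1 + x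
    /\ (forall c, a < c < x -> psum g x + c < psum g c + x).
  case/orP: ex => [/eqP->|Rax]; last by apply: IH => //; lia.
  split; last by lia.
  rewrite sum_nat_pred0 ?addn0 // => y ya; apply/negP => Ray.
  by have := arc_gap sysR Ray; lia.
have [hb rb] : psum g b + x.+1 = psum g x + b
    /\ (forall c, x < c < b -> psum g b + c < psum g c + b).
  have gx := outdeg_inner Rab xab; have px := psumS g x.
  case: (perfect_triangle sysR perfR ap) => [eb|Rxb].
    subst b; split; last by lia.
    rewrite px gx sum_nat_pred0; first lia.
    move=> y ya; apply/negP => Rxy.
    by have := arc_gap sysR Rxy; lia.
  have [|hxb rxb] := IH x b _ Rxb; first lia.
  by split=> //; lia.
rewrite (sum_out_apex ap); split; first lia.
by move=> c cab; case: (ltngtP c x) => [cx|xc|->]; [have := rx c|have := rb c|]; lia.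
Qed.

Lemma arc_walk a b : R a b -> walk_arc g a b.
Proof.
move=> Rab; have [hb rb] := arc_psum Rab; have gab := arc_gap sysR Rab.
apply/walk_arcP; split=> //; first lia.
have : \sum_(a <= y < b.+1) R a y <= g a.
  by rewrite /outdeg (@big_cat_nat _ _ _ b.+1 a (a + n)) ?leq_addr //=; lia.
have := psumS g a; lia.
Qed.

(** Every arc of [R] is a walk arc, and both systems have the same out-degree at [a], so no further
    walk arc can exist. *)
Lemma walk_arc_outdeg a b : walk_arc g a b = R a b.
Proof.
apply/idP/idP; last exact: arc_walk.
move=> Wab; apply/negPn/negP => nRab.
have gper i : g (i + n) = g i by apply: outdeg_per.
have gab := arc_gap (walk_arc_system gper k_gt2 sum_outdeg) Wab.
have := outdeg_walk_arc gper k_gt2 sum_outdeg a; apply/eqP.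
rewrite /outdeg (eq_bigr (fun y => R a y + (walk_arc g a y && ~~ R a y))).
  rewrite big_split /= -[X in _ != X]addn0 eqn_add2l.
  rewrite sum_nat_seq_eq0; apply/allPn; exists b; first by rewrite mem_index_iota; lia.
  by rewrite Wab nRab.
by move=> y _; case Ray: (R a y); rewrite ?(arc_walk Ray) ?andbT.
Qed.

End Reconstruction.

(** * Arc systems and the n-gon *)

Lemma apex_fun R a b x y : apex R a b x -> apex R a b y -> x = y.
Proof.
have main u v : apex R a b u -> apex R a b v -> u <= v.
  case=> Rab uab /orP eu mu [_ vab /orP ev mv].
  rewrite leqNgt; apply/negP => vu.
  case: eu => [|Rau]; first lia.
  by have := mv u; rewrite Rau; lia.
by move=> A1 A2; apply/eqP; rewrite eqn_leq !main.
Qed.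

Section Polygon.

Variable p : nat.
Local Notation n := p.+1.

Definition vx (a : nat) : 'I_n := Ordinal (ltn_pmod a (ltn0Sn p)).

(** Reduction modulo [n] may reverse the endpoints, so they are sorted to fit the encoding of
    diagonals; the orientation is forgotten. *)
Definition dpair (a b : nat) : 'I_n * 'I_n :=
  if vx a < vx b then (vx a, vx b) else (vx b, vx a).

Lemma vx_ord (i : 'I_n) : vx i = i.
Proof. by apply: val_inj; rewrite /= modn_small. Qed.

Lemma vxDM a q : vx (a + q * n) = vx a.
Proof. by apply: val_inj; rewrite /= addnC modnMDl. Qed.

Lemma vxD a : vx (a + n) = vx a.
Proof. by rewrite -[n in a + n]mul1n vxDM. Qed.

Lemma dpairDM a b q : dpair (a + q * n) (b + q * n) = dpair a b.
Proof. by rewrite /dpair !vxDM. Qed.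

Lemma vx_eq a b : vx a = vx b -> exists q, a = b + q * n \/ b = a + q * n.
Proof.
move/(congr1 val) => /= e; rewrite (divn_eq a n) (divn_eq b n) e.
case: (leqP (a %/ n) (b %/ n)) => h.
  by exists (b %/ n - a %/ n); right; rewrite addnAC -mulnDl subnKC.
by exists (a %/ n - b %/ n); left; rewrite addnAC -mulnDl subnKC // ltnW.
Qed.

Lemma vx_inj a b : a <= b < a + n -> vx a = vx b -> a = b.
Proof. by move=> ab /vx_eq[[|q]]; nia. Qed.

Lemma vx_surj a (i : 'I_n) : exists2 c, a <= c < a + n & vx c = i.
Proof.
have := ltn_ord i; have := divn_eq a n; have : a %% n < n by rewrite ltn_pmod.
move: (a %/ n) (a %% n) => q r rn ea i_n.
case: (leqP r i) => ri.
  exists (i + q * n); last by rewrite vxDM vx_ord.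
  by lia.
exists (i + q.+1 * n); last by rewrite vxDM vx_ord.
by rewrite mulSn; lia.
Qed.

Lemma dpair_lt (i j : 'I_n) : i < j -> dpair i j = (i, j).
Proof. by move=> ij; rewrite /dpair !vx_ord ij. Qed.

Lemma dpair_wrap (i j : 'I_n) : i < j -> dpair j (i + n) = (i, j).
Proof. by move=> ij; rewrite /dpair vxD !vx_ord ltnNge (ltnW ij). Qed.

Section Diagonals.

Variable R : rel nat.
Hypothesis sysR : arc_system n R.

Definition diagonals : {set 'I_n * 'I_n} :=
  [set d : 'I_n * 'I_n | (d.1 < d.2) && (R d.1 d.2 || R d.2 (d.1 + n))].

(** The vertex is read at [v + n], so that an arc over it starts at a natural number; arcs being
    shorter than [n], the bounds [2n] and [3n] lose nothing. *)
Definition cover : {set 'I_n} :=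
  [set v : 'I_n | [exists a : 'I_(n + n), [exists b : 'I_(n + n + n),
     R a b && (a < v + n < b)]]].

Lemma arc_base a b : R a b -> exists q c d,
  [/\ a = c + q * n, b = d + q * n, R c d & c < n].
Proof.
move=> Rab; have gab := arc_gap sysR Rab.
have ea := divn_eq a n; have an : a %% n < n by rewrite ltn_pmod.
exists (a %/ n), (a %% n), (b - a %/ n * n).
have ec : a = a %% n + a %/ n * n by rewrite addnC.
have eb : b = (b - a %/ n * n) + a %/ n * n by lia.
by split=> //; rewrite -(arc_perM sysR (a %/ n)) -ec -eb.
Qed.

Lemma mem_diagonals a b : R a b -> dpair a b \in diagonals.
Proof.
case/arc_base => q [c [d [-> -> Rcd cn]]]; rewrite dpairDM.
have gcd := arc_gap sysR Rcd.
have ec : c = Ordinal cn :> nat by [].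
case: (ltnP d n) => dn.
  have ed : d = Ordinal dn :> nat by [].
  have lt : Ordinal cn < Ordinal dn by rewrite -ec -ed; lia.
  by rewrite ec ed dpair_lt // inE /= Rcd; lia.
have dn' : d - n < n by lia.
have lt : Ordinal dn' < Ordinal cn by rewrite /=; lia.
have ed : d = Ordinal dn' + n by rewrite /=; lia.
by rewrite ec ed dpair_wrap // inE -ed -ec Rcd orbT andbT.
Qed.

Lemma diagonals_arc d : d \in diagonals ->
  exists a b, [/\ R a b, a < n & dpair a b = d].
Proof.
case: d => i j; rewrite inE /= => /andP[ij /orP[]] Rij.
  by exists i, j; rewrite dpair_lt.
by exists j, (i + n); rewrite dpair_wrap.
Qed.

(** With equal orientations, the short length of arcs turns congruence of the ends into equality.
    Opposite orientations would give an arc and its reversal, excluded by [arc_asym]. *)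
Lemma dpair_inj a b c d : R a b -> R c d -> dpair a b = dpair c d ->
  exists q, (a = c + q * n /\ b = d + q * n) \/ (c = a + q * n /\ d = b + q * n).
Proof.
move=> Rab Rcd eqd.
have gab := arc_gap sysR Rab; have gcd := arc_gap sysR Rcd.
have : (vx a = vx c /\ vx b = vx d) \/ (vx a = vx d /\ vx b = vx c).
  move: (congr1 fst eqd) (congr1 snd eqd); rewrite /dpair.
  by do 2!case: ifP => _ /=; auto.
case=> -[].
  have same u v z : R u v -> R u z -> vx v = vx z -> v = z.
    move=> Ruv Ruz evz; have guv := arc_gap sysR Ruv; have guz := arc_gap sysR Ruz.
    by case: (leqP v z) => vz; [|apply/esym]; apply: vx_inj => //; lia.
  move=> /vx_eq[q [ea|ec]] ebd; exists q; [left|right]; split=> //.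
    rewrite -(arc_perM sysR q c) -ea in Rcd.
    by apply: same Rab Rcd _; rewrite vxDM.
  rewrite -(arc_perM sysR q a) -ec in Rab.
  by apply: same Rcd Rab _; rewrite vxDM.
have bad u v z : R u v -> R v z -> vx z = vx u -> False.
  move=> Ruv Rvz ezu; have := arc_asym sysR Ruv.
  have guv := arc_gap sysR Ruv; have gvz := arc_gap sysR Rvz.
  suff -> : u + n = z by rewrite Rvz.
  case: (leqP z (u + n)) => le; last by apply: vx_inj; [lia|rewrite vxD ezu].
  by apply/esym; apply: vx_inj; [lia|rewrite vxD ezu].
move=> ead /vx_eq[r [eb|ec]]; exfalso.
  rewrite -(arc_perM sysR r c) -eb in Rcd.
  by apply: bad Rab Rcd _; rewrite vxDM.
rewrite -(arc_perM sysR r a) -ec in Rab.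
by apply: bad Rab Rcd _; rewrite vxDM.
Qed.

Lemma covered_perM q x : covered R x -> covered R (x + q * n).
Proof.
case=> a [b [Rab axb]]; exists (a + q * n), (b + q * n).
by rewrite (arc_perM sysR) Rab; split=> //; lia.
Qed.

Lemma coverP (v : 'I_n) : reflect (covered R (v + n)) (v \in cover).
Proof.
rewrite inE; apply: (iffP existsP) => [[a /existsP[b /andP[Rab avb]]]|].
  by exists a, b.
case=> a [b [Rab avb]]; have gab := arc_gap sysR Rab.
have lv := ltn_ord v.
have an : a < n + n by lia.
have bn : b < n + n + n by lia.
by exists (Ordinal an); apply/existsP; exists (Ordinal bn); rewrite Rab.
Qed.

Lemma mem_cover x : covered R x -> vx x \in cover.
Proof.
move=> cx; apply/coverP.
have [q [e|e]] := vx_eq (esym (vx_ord (vx x))); last first.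
  have : covered R (x + q.+1 * n) by apply: covered_perM.
  by rewrite mulSnr addnA -e.
case: q e => [|q] e.
  by rewrite addn0 in e; rewrite -e -[n in _ + n]mul1n; apply: covered_perM.
case: cx => a [b [Rab axb]]; have gab := arc_gap sysR Rab.
rewrite mulSn addnA in e.
exists (a - q * n), (b - q * n); split; last by lia.
by rewrite -(arc_perM sysR q) !subnK //; lia.
Qed.

Lemma vx_apex_inj a b x c d y : apex R a b x -> apex R c d y -> vx x = vx y ->
  dpair a b = dpair c d.
Proof.
move=> ax cy /vx_eq[q [] e].
  have := apex_per sysR q cy; rewrite -e => /(apex_inj sysR ax)[-> ->].
  by rewrite dpairDM.
have := apex_per sysR q ax; rewrite -e => /(apex_inj sysR cy)[-> ->].
by rewrite dpairDM.
Qed.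

Lemma apex_covered a b x : apex R a b x -> covered R x.
Proof. by case=> Rab axb _ _; exists a, b. Qed.

(** A single choice of apexes, injecting the diagonals into the covered vertices; both cardinality
    comparisons below rest on it. *)
Lemma apex_map : exists f : 'I_n * 'I_n -> 'I_n,
  [/\ forall d, d \in diagonals -> exists a b x,
         [/\ apex R a b x, a < n, dpair a b = d & f d = vx x],
      {in diagonals &, injective f} & f @: diagonals \subset cover].
Proof.
have : forall d, exists v, d \in diagonals -> exists a b x,
    [/\ apex R a b x, a < n, dpair a b = d & v = vx x].
  move=> d; case: (boolP (d \in diagonals)) => [/diagonals_arc|_]; last by exists ord0.
  case=> a [b [Rab an eab]]; have [x ax] := apex_exists sysR Rab.
  by exists (vx x) => _; exists a, b, x.
case/fin_all_exists => f fP; exists f; split=> //.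
  move=> d e /fP[a [b [x [ax _ <- ->]]]] /fP[c [z [y [cy _ <- ->]]]].
  exact: vx_apex_inj.
apply/subsetP => v /imsetP[d].
by case/fP=> a [b [x [ax _ _ ->]]] ->; apply/mem_cover/apex_covered/ax.
Qed.

Lemma card_diagonals_le : #|diagonals| <= #|cover|.
Proof.
have [f [_ finj fcov]] := apex_map.
by rewrite -(card_in_imset finj) subset_leq_card.
Qed.

Lemma perfect_card : #|cover| <= #|diagonals| -> perfect n R.
Proof.
have [f [fP finj fcov]] := apex_map.
rewrite -(card_in_imset finj) => le.
have eqcov : f @: diagonals = cover by apply/eqP; rewrite eqEcard fcov.
move=> x nx /mem_cover; rewrite -eqcov => /imsetP[d].
case/fP=> a [b [y [ay an _ ->]]] /vx_eq[q e].
(* Since [a < n], the apex [y] is below [2n], while [x] is at least [n]; hence [y] cannot be a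
   positive number of periods after [x]. *)
have eq : x = y + q * n.
  case: e => [//|]; have [Rab axb _ _] := ay; have gab := arc_gap sysR Rab.
  by case: q => [|q]; rewrite ?mulSn; lia.
by exists (a + q * n), (b + q * n); rewrite eq; apply: apex_per.
Qed.

Lemma card_cover_le : perfect n R -> #|cover| <= #|diagonals|.
Proof.
move=> perfR; have [f [fP _ _]] := apex_map.
apply: leq_trans (leq_imset_card f _); apply/subset_leq_card/subsetP => v.
case/coverP/(perfR _ (leq_addl _ _)) => a [b ab].
have [Rab _ _ _] := ab; apply/imsetP; exists (dpair a b); first exact: mem_diagonals.
have [c [d [y [cd _ e ->]]]] := fP _ (mem_diagonals Rab).
rewrite -[v in LHS]vx_ord -vxD; have [Rcd _ _ _] := cd.
have [q [[ec ed]|[ea eb]]] := dpair_inj Rcd Rab e.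
  by rewrite (apex_fun cd (y := v + n + q * n)) ?vxDM //
     ec ed; apply: apex_per.
by rewrite (apex_fun ab (y := y + q * n)) ?vxDM // ea eb; apply: apex_per.
Qed.

(** The arcs from [i] are split at [n] into those that stay in the period and those that wrap. A
    pair [i < j] then arises from [i] to [j] or from [j] to [i + n], and [arc_asym] forbids both. *)
Lemma sum_outdeg : \sum_(0 <= a < n) outdeg n R a = #|diagonals|.
Proof.
have irr (i : 'I_n) : R i i = false.
  by apply/negP => /(arc_gap sysR); lia.
have dec (i : 'I_n) : outdeg n R i =
    \sum_(j < n) ((i < j) && R i j) + \sum_(j < n) ((j < i) && R i (j + n)).
  rewrite /outdeg (@big_cat_nat _ _ _ n) ?leq_addl //=; last exact: ltnW.
  congr (_ + _).
    rewrite (@big_nat_widenl _ _ _ i 0) // big_mkord big_mkcond; apply: eq_bigr => j _ /=.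
    by case: ltngtP => //= <-; rewrite irr.
  rewrite -{1}[n]add0n big_addn addnK big_mkord.
  rewrite (@big_ord_widen_cond _ _ _ i n predT (fun j => R i (j + n) : nat)); last exact: ltnW.
  by rewrite big_mkcond; apply: eq_bigr => j _ /=; case: ltnP.
rewrite big_mkord (eq_bigr _ (fun i _ => dec i)) big_split /=.
rewrite [X in _ + X]exchange_big -big_split /= -sum1_card [in RHS]big_mkcond /=.
rewrite (eq_bigr (fun i : 'I_n => \sum_(j < n) ((i, j) \in diagonals))).
  by rewrite pair_bigA; apply: eq_bigr => -[i j] _ /=; case: ifP.
move=> i _; rewrite -big_split; apply: eq_bigr => j _; rewrite inE /=.
case: ltnP => //= _; case Rij: (R i j) => //=.
by rewrite (negbTE (arc_asym sysR Rij)).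
Qed.

End Diagonals.
End Polygon.

Lemma third_point (T : finType) (A : {set T}) x y :
  2 < #|A| -> exists z, [/\ z \in A, z != x & z != y].
Proof.
move=> A3; have : 0 < #|A :\: [set x; y]|.
  have := cardsID [set x; y] A; have := cards2 x y.
  have := subset_leq_card (subsetIr A [set x; y]); lia.
by case/card_gt0P => z; rewrite !inE negb_or => /andP[/andP[zx zy] zA]; exists z.
Qed.

Arguments vx : simpl never.

(** * Sides and crossings of diagonals in terms of arcs *)

Section Sides.

Variable p : nat.
Local Notation n := p.+1.
Local Notation vx := (@vx p).
Local Notation dpair := (@dpair p).

Lemma val_vx c : (c < n -> vx c = c :> nat) /\ (n <= c < n + n -> vx c = c - n :> nat).
Proof.
rewrite /vx /=; split=> [cn|/andP[nc cn]]; first by rewrite modn_small.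
by rewrite -{1}(subnK nc) modnDr modn_small //; lia.
Qed.

Lemma base_shift a : exists q r, r < n /\ a = r + q * n.
Proof. by exists (a %/ n), (a %% n); rewrite ltn_pmod // addnC -divn_eq. Qed.

(** The test [vx a < vx b] detects that the arc does not wrap past vertex 0, which is when the
    vertices from [a] to [b] form the first side of the diagonal. *)
Lemma side_behind a b c : a.+1 < b < a + n -> a <= c < a + n ->
  (vx c \in side (vx a < vx b) (dpair a b)) = (c <= b).
Proof.
have [q [r [rn ->]]] := base_shift a => rb rc.
have [b' eb] : exists b', b = b' + q * n by exists (b - q * n); lia.
have [c' ec] : exists c', c = c' + q * n by exists (c - q * n); lia.
subst b c; rewrite dpairDM !vxDM leq_add2r /dpair.
have {}rb : r.+1 < b' < r + n by lia.
have {}rc : r <= c' < r + n by lia.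
move: (val_vx r) (val_vx b') (val_vx c').
move: (vx r) (vx b') (vx c') => u v w hu hv hw.
have {}hu : u = r :> nat by lia.
have {}hv : v = (if b' < n then b' else b' - n) :> nat by case: ifP; lia.
have {}hw : w = (if c' < n then c' else c' - n) :> nat by case: ifP; lia.
case: (ltnP b' n) hv => lb hv; case: (ltnP c' n) hw => lc hw;
rewrite hu hv; case: ifP => h; rewrite /side inE /= ?hu ?hv ?hw; lia.
Qed.

Lemma side_front a b c : a.+1 < b < a + n -> a <= c < a + n ->
  (vx c \in side (~~ (vx a < vx b)) (dpair a b)) = (c == a) || (b <= c).
Proof.
have [q [r [rn ->]]] := base_shift a => rb rc.
have [b' eb] : exists b', b = b' + q * n by exists (b - q * n); lia.
have [c' ec] : exists c', c = c' + q * n by exists (c - q * n); lia.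
subst b c; rewrite dpairDM !vxDM leq_add2r eqn_add2r /dpair.
have {}rb : r.+1 < b' < r + n by lia.
have {}rc : r <= c' < r + n by lia.
move: (val_vx r) (val_vx b') (val_vx c').
move: (vx r) (vx b') (vx c') => u v w hu hv hw.
have {}hu : u = r :> nat by lia.
have {}hv : v = (if b' < n then b' else b' - n) :> nat by case: ifP; lia.
have {}hw : w = (if c' < n then c' else c' - n) :> nat by case: ifP; lia.
case: (ltnP b' n) hv => lb hv; case: (ltnP c' n) hw => lc hw;
rewrite hu hv; case: ifP => h; rewrite /side inE /= ?hu ?hv ?hw; lia.
Qed.

Lemma crossing_dpair a b c d : a < c < b -> b < d < a + n ->
  crossing (dpair a b) (dpair c d).
Proof.
have [q [r [rn ->]]] := base_shift a => rb rc.
have [b' eb] : exists b', b = b' + q * n by exists (b - q * n); lia.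
have [c' ec] : exists c', c = c' + q * n by exists (c - q * n); lia.
have [d' ed] : exists d', d = d' + q * n by exists (d - q * n); lia.
subst b c d; rewrite !dpairDM /dpair.
have {}rb : r < c' < b' by lia.
have {}rc : b' < d' < r + n by lia.
move: (val_vx r) (val_vx b') (val_vx c') (val_vx d').
move: (vx r) (vx b') (vx c') (vx d') => u v w z hu hv hw hz.
have {}hu : u = r :> nat by lia.
case: (ltnP d' n) => ld.
  have -> : u < v by lia.
  have -> : w < z by lia.
  by apply/orP; left => /=; lia.
have {}hz : z = d' - n :> nat by lia.
case: (ltnP b' n) => lb.
  have -> : u < v by lia.
  have -> : (w < z) = false by lia.
  by apply/orP; right => /=; lia.
have {}hv : v = b' - n :> nat by lia.
case: (ltnP c' n) => lc.
  have -> : (u < v) = false by lia.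
  have -> : (w < z) = false by lia.
  by apply/orP; left => /=; lia.
have -> : (u < v) = false by lia.
have -> : w < z by lia.
by apply/orP; right => /=; lia.
Qed.

End Sides.

(** * Dissections with a marked part *)

Section ArcsOfDissection.

Variable p : nat.
Local Notation n := p.+1.
Local Notation vx := (@vx p).
Local Notation dpair := (@dpair p).

Variables (D : {set 'I_n * 'I_n}) (S : {set 'I_n}).

(** The chosen side is the one running from [b] on to [a + n], so each diagonal is oriented with [S]
    in front of it. *)
Definition arcs : rel nat := fun a b =>
  [&& a.+1 < b, b < a + n, dpair a b \in D
    & S \subset side (~~ (vx a < vx b)) (dpair a b)].

Hypothesis diagD : forall d, d \in D -> is_diagonal d.
Hypothesis noncrossD : forall d e, d \in D -> e \in D -> ~~ crossing d e.
Hypothesis partS : S \in parts D.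

Lemma card_part : 2 < #|S|.
Proof. by move: partS; rewrite inE => /andP[]. Qed.

Lemma arc_avoids a b c : arcs a b -> a < c < b -> vx c \notin S.
Proof.
case/and4P=> ab ban _ /subsetP sub acb; apply/negP => /sub.
by rewrite side_front; lia.
Qed.

(** Overlapping arcs either cross, or together pass over every vertex but [vx a]; an arc and its
    reversal pass over all but two. As [S] has three vertices, it would meet the interior of an
    arc. *)
Lemma arcs_system : arc_system n arcs.
Proof.
split.
- by move=> a b /and4P[-> -> _ _].
- by move=> a b; rewrite /arcs /dpair !vxD -addSn !ltn_add2r.
- move=> a b c d Rab Rcd acb; rewrite leqNgt; apply/negP => bd.
  have /and4P[_ ban Dab _] := Rab; have /and4P[_ dcn Dcd _] := Rcd.
  case: (ltnP d (a + n)) => dan.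
    have := noncrossD Dab Dcd; rewrite crossing_dpair //; lia.
  have [s [sS sa _]] := third_point (vx a) (vx a) card_part.
  have [e ae es] := vx_surj a s.
  have nea : e != a by apply: contraNneq sa => <-; rewrite es.
  rewrite -es in sS; case: (ltnP e b) => eb.
    by have := arc_avoids (c := e) Rab; rewrite sS; lia.
  by have := arc_avoids (c := e) Rcd; rewrite sS; lia.
- move=> a b Rab; apply/negP => Rba.
  have [s [sS sa sb]] := third_point (vx a) (vx b) card_part.
  have [e ae es] := vx_surj a s.
  have nea : e != a by apply: contraNneq sa => <-; rewrite es.
  have neb : e != b by apply: contraNneq sb => <-; rewrite es.
  rewrite -es in sS; case: (ltnP e b) => eb.
    by have := arc_avoids (c := e) Rab; rewrite sS; lia.
  by have := arc_avoids (c := e) Rba; rewrite sS; lia.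
Qed.

Lemma arcs_cases (i j : 'I_n) : (i, j) \in D -> [/\ i < j, i.+1 < j < i + n & j.+1 < i + n].
Proof.
move=> /diagD /andP[/= ij bd]; have := ltn_ord j; have := ltn_ord i.
by split; lia.
Qed.

Lemma part_sides : exists E : {set 'I_n * 'I_n}, 
  [/\ forall v, v \in S <-> (forall d, d \in D -> v \in side (d \in E) d)
    & forall i j, (i, j) \in D ->
        if (i, j) \in E then arcs j (i + n) else arcs i j].
Proof.
move: partS; rewrite inE => /andP[_ /existsP[E /eqP eS]]; exists E.
have memS v : v \in S <-> (forall d, d \in D -> v \in side (d \in E) d).
  by rewrite eS; split=> [/bigcapP|h]; last apply/bigcapP.
split=> // i j ijD; have [ij g1 g2] := arcs_cases ijD.
have sub : S \subset side ((i, j) \in E) (i, j).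
  by apply/subsetP => v /memS; apply.
case: ifP sub => ijE sub; rewrite /arcs.
  rewrite dpair_wrap // vxD !vx_ord ijD (leq_gtF (ltnW ij)) sub; lia.
by rewrite dpair_lt // !vx_ord ijD ij sub; lia.
Qed.

Lemma diagonals_arcs : diagonals p arcs = D.
Proof.
have [E [_ ED]] := part_sides.
apply/setP => -[i j]; rewrite inE /=; apply/andP/idP.
  case=> ij /orP[] /and4P[_ _]; first by rewrite dpair_lt.
  by rewrite dpair_wrap.
move=> ijD; have [ij _ _] := arcs_cases ijD; split=> //.
by have := ED _ _ ijD; case: ifP => _ ->; rewrite ?orbT.
Qed.

(** [S] is the intersection of the sides chosen by [E], and [part_sides] makes these the front sides
    of the arcs. A front side omits only the vertices strictly under its arc. *)
Lemma cover_arcs : ~: cover p arcs = S.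
Proof.
have [E [memS ED]] := part_sides.
apply/setP => v; rewrite inE; apply/idP/idP; last first.
  apply: contraL => /(coverP arcs_system)[a [b [Rab avb]]].
  by rewrite -[v]vx_ord -vxD; apply: arc_avoids Rab avb.
move=> nv; apply/memS => -[i j] ijD.
have [ij g1 g2] := arcs_cases ijD.
have main a b : arcs a b -> dpair a b = (i, j) ->
    v \in side (~~ (vx a < vx b)) (i, j).
  move=> Rab <-; have [c ac ev] := vx_surj a v; rewrite -ev.
  have := arc_gap arcs_system Rab => gab.
  rewrite side_front //; have [//|ca] := eqVneq c a; rewrite leqNgt /=.
  apply: contraNN nv => cb; rewrite -ev; apply: mem_cover; first exact: arcs_system.
  by exists a, b; split=> //; lia.
have := ED _ _ ijD; case: ifP => _ Rd.
  have := main _ _ Rd; rewrite vxD !vx_ord dpair_wrap // => /(_ erefl).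
  by rewrite (leq_gtF (ltnW ij)).
by have := main _ _ Rd; rewrite !vx_ord dpair_lt // ij => /(_ erefl).
Qed.

End ArcsOfDissection.

(** * The dissection and marked part given by an arc system *)

Section DissectionOfArcs.

Variables (p : nat) (R : rel nat).
Local Notation n := p.+1.
Local Notation vx := (@vx p).
Local Notation dpair := (@dpair p).
Local Notation S := (~: cover p R).

Hypothesis sysR : arc_system n R.

Lemma cover_avoids a b c : R a b -> a < c < b -> vx c \in cover p R.
Proof. by move=> Rab acb; apply: mem_cover => //; exists a, b. Qed.

Lemma arc_orient a b : R a b -> if vx a < vx b then R (vx a) (vx b)
  else R (vx a) (vx b + n).
Proof.
have [q [r [rn ->]]] := base_shift p a => Rab; have gab := arc_gap sysR Rab.
have [c ec] : exists c, b = c + q * n by exists (b - q * n); lia.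
subst b; rewrite arc_perM // in Rab; rewrite !vxDM.
have {}gab : r.+1 < c < r + n by lia.
have [er _] := val_vx p r; have [ec1 ec2] := val_vx p c.
rewrite er //; case: (ltnP c n) => cn.
  by rewrite ec1 //; case: ifP => //; lia.
by rewrite ec2 ?subnK //; first case: ifP => //; lia.
Qed.

(** This is the set [E] witnessing that the uncovered vertices form a part: the first side is the
    front one exactly when the arc wraps. *)
Definition wrapped : {set 'I_n * 'I_n} :=
  [set d : 'I_n * 'I_n | R d.2 (d.1 + n)].

Lemma mem_wrapped a b : R a b -> (dpair a b \in wrapped) = ~~ (vx a < vx b).
Proof.
move/arc_orient; rewrite /dpair inE; case: ifP => /= lt Rd //.
by apply: negbTE; apply: arc_asym Rd.
Qed.

Lemma cover_bigcap :
  S = \bigcap_(d in diagonals p R) side (d \in wrapped) d.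
Proof.
apply/setP => v; rewrite inE; apply/idP/bigcapP => [nv d|vD].
  case/diagonals_arc=> a [b [Rab _ <-]]; rewrite mem_wrapped //.
  have gab := arc_gap sysR Rab; have [c ac ev] := vx_surj a v.
  rewrite -ev side_front //; have [//|ca] := eqVneq c a; rewrite leqNgt /=.
  apply: contraNN nv => cb; rewrite -ev; apply: (cover_avoids Rab); lia.
apply/negP => /(coverP sysR)[a [b [Rab avb]]].
have := vD _ (mem_diagonals sysR Rab); rewrite mem_wrapped //.
have gab := arc_gap sysR Rab.
by rewrite -[v]vx_ord -vxD side_front //; lia.
Qed.

(** For each of the four pairs of orientations, a crossing makes one arc start inside the other and
    end beyond it, possibly after a shift by a period. *)
Lemma diagonals_noncrossing d e :
  d \in diagonals p R -> e \in diagonals p R -> ~~ crossing d e.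
Proof.
have main (i j i' j' : 'I_n) : i < i' -> i' < j -> j < j' ->
    R i j || R j (i + n) -> R i' j' || R j' (i' + n) -> False.
  move=> h1 h2 h3; have li := ltn_ord j'.
  case/orP => Rd /orP[] Re.
  - have := arc_lam sysR Rd Re; lia.
  - rewrite -(arc_per sysR) in Rd; have := arc_lam sysR Re Rd; lia.
  - have := arc_lam sysR Re Rd; lia.
  - have := arc_lam sysR Rd Re; lia.
case: d e => [i j] [i' j']; rewrite !inE /= => /andP[_ Rd] /andP[_ Re].
by apply/negP => /orP[] /and3P[h1 h2 h3];
  [apply: main Rd Re | apply: main Re Rd].
Qed.

Hypothesis S_gt2 : 2 < #|S|.

(** An arc ending at [a + n - 1] would leave only its two endpoints in front, too few for the
    uncovered set. *)
Lemma arc_gap_strict a b : R a b -> b.+1 < a + n.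
Proof.
move=> Rab; have gab := arc_gap sysR Rab.
have [s [sS sa sb]] := third_point (vx a) (vx b) S_gt2.
have [e ae es] := vx_surj a s.
have nea : e != a by apply: contraNneq sa => <-; rewrite es.
have neb : e != b by apply: contraNneq sb => <-; rewrite es.
move: sS; rewrite inE -es; case: (ltnP e b) => eb; last by lia.
by rewrite (cover_avoids Rab) //; lia.
Qed.

Lemma diagonals_is_diagonal d : d \in diagonals p R -> is_diagonal d.
Proof.
case: d => i j; rewrite inE /is_diagonal /= => /andP[ij /orP[]] Rd;
  have := arc_gap sysR Rd; have := arc_gap_strict Rd; lia.
Qed.

Lemma cover_in_parts : S \in parts (diagonals p R).
Proof. by rewrite inE S_gt2; apply/existsP; exists wrapped; rewrite -cover_bigcap. Qed.

End DissectionOfArcs.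

(** * The parts of a perfect system *)

Section Triangles.

Variables (p : nat) (R : rel nat).
Local Notation n := p.+1.
Local Notation vx := (@vx p).
Local Notation dpair := (@dpair p).
Local Notation S := (~: cover p R).
Local Notation D := (diagonals p R).
Local Notation behind a b := (side (vx a < vx b) (dpair a b)).
Local Notation front a b := (side (~~ (vx a < vx b)) (dpair a b)).

Hypotheses (sysR : arc_system n R) (perfR : perfect n R).

Definition triangle (a x b : nat) : {set 'I_n} := [set vx a; vx x; vx b].

Lemma card_triangle a b x : apex R a b x -> #|triangle a x b| = 3.
Proof.
case=> Rab axb _ _; have gab := arc_gap sysR Rab.
have ne u v : u < v < u + n -> vx u != vx v.
  by move=> uv; apply/eqP => /vx_inj; lia.
by rewrite /triangle setUC cardsU1 cards2 !inE negb_or ![vx b == _]eq_sym !ne //; lia.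
Qed.

Lemma triangle_sub (A : {set 'I_n}) a b x :
  (triangle a x b \subset A) = [&& vx a \in A, vx x \in A & vx b \in A].
Proof. by rewrite !subUset !sub1set -andbA. Qed.

Lemma sub_triangle (A : {set 'I_n}) a b x : apex R a b x ->
  A \subset behind a b -> (R a x -> A \subset front a x) ->
  (R x b -> A \subset front x b) -> A \subset triangle a x b.
Proof.
move=> ax /subsetP Aab Aax Axb; have tr := perfect_triangle sysR perfR ax.
have [Rab axb ex _] := ax; have gab := arc_gap sysR Rab.
apply/subsetP => v vA; have [c ac ev] := vx_surj a v; subst v.
have := Aab _ vA; rewrite side_behind // => cb.
have cx : c = a \/ x <= c.
  case/orP: ex => [/eqP->|Rax]; first lia.
  have gax := arc_gap sysR Rax.
  have := subsetP (Aax Rax) _ vA; rewrite side_front //.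
  by case/orP => [/eqP|]; [left|right].
case: cx => [->|xc]; first by rewrite !inE eqxx.
have : c = x \/ c = b.
  case: tr => [|Rxb]; first lia.
  have gxb := arc_gap sysR Rxb.
  by have := subsetP (Axb Rxb) _ vA; rewrite side_front //; lia.
by case=> ->; rewrite !inE eqxx ?orbT.
Qed.

Lemma part_side A a b : A \in parts D -> R a b ->
  A \subset behind a b \/ A \subset front a b.
Proof.
rewrite inE => /andP[_ /existsP[E /eqP eA]] Rab.
have sub : A \subset side (dpair a b \in E) (dpair a b).
  by rewrite eA; apply: bigcap_inf; apply: mem_diagonals.
by move: sub; case: (_ \in E); case: (vx a < vx b); auto.
Qed.

(** Shift [c] into the period starting at [a]. From [c >= b], laminarity makes the arc stop by
    [a + n] or pass [b + n]. From [c = a], it ends by [x] or at least at [b], by the choice of apex.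
    Otherwise it stays within [a] to [x] or within [x] to [b]. *)
Lemma triangle_side a b x c d : apex R a b x -> R c d ->
  triangle a x b \subset behind c d \/ triangle a x b \subset front c d.
Proof.
move=> ax; wlog acn : c d / a <= c < a + n.
  move=> main Rcd; have [c' ac' /vx_eq[q [ec|ec]]] := vx_surj a (vx c).
    have := main (c + q * n) (d + q * n); rewrite !vxDM dpairDM (arc_perM sysR).
    by apply=> //; lia.
  have gcd := arc_gap sysR Rcd.
  have ed : d = d - q * n + q * n by lia.
  rewrite ed ec in Rcd *; rewrite (arc_perM sysR) in Rcd.
  by rewrite !vxDM dpairDM; apply: main.
move=> Rcd; have gcd := arc_gap sysR Rcd.
have [Rab axb ex mx] := ax; have gab := arc_gap sysR Rab.
have Rab' : R (a + n) (b + n) by rewrite (arc_per sysR).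
have inb u : c <= u <= d \/ c <= u + n <= d -> vx u \in behind c d.
  by case=> hu; [|rewrite -vxD]; rewrite side_behind //; lia.
have inf u : u = c \/ d <= u < c + n \/ d <= u + n < c + n -> vx u \in front c d.
  by case=> [|[]] hu; [| |rewrite -vxD]; rewrite side_front //; lia.
rewrite !triangle_sub; case: (leqP b c) => bc.
  case: (leqP d (a + n)) => da; [right|left].
    by rewrite !inf //; lia.
  have bnd := arc_lam sysR Rcd Rab'.
  by rewrite !inb //; lia.
have [ca|ca] := eqVneq c a.
  case: (leqP b d) => bd; [left|right]; first by rewrite !inb //; lia.
  have dx : d <= x.
    by rewrite leqNgt; apply/negP => xd; have := mx d; rewrite -ca Rcd; lia.
  by rewrite !inf //; lia.
have db := arc_lam sysR Rab Rcd; right.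
case: (ltnP c x) => cx; last by rewrite !inf //; lia.
case/orP: ex => [|Rax]; first lia.
have dx := arc_lam sysR Rax Rcd.
by rewrite !inf //; lia.
Qed.

(** Up to a period, [c] is [a], [x] or [b], and the arc from [c] passes over the second vertex to
    the third in cyclic order. Starting at [x] or [b] it would be an arc from [x] to [a + n] or from
    [b] to [x + n], which is not laminar with the arc from [a] to [b]. *)
Lemma triangle_inj a b x c d y : apex R a b x -> apex R c d y ->
  triangle a x b = triangle c y d -> dpair a b = dpair c d.
Proof.
have core a' b' x' c' d' y' : apex R a' b' x' -> apex R c' d' y' ->
    [|| c' == a', c' == x' | c' == b'] -> vx y' \in triangle a' x' b' ->
    vx d' \in triangle a' x' b' -> c' = a' /\ d' = b'.
  move=> {a b x c d y} [] Rab axb _ _ [] Rcd cyd _ _.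
  move: a' b' x' c' d' y' Rab axb Rcd cyd => a b x c d y Rab axb Rcd cyd.
  have gab := arc_gap sysR Rab; have gcd := arc_gap sysR Rcd.
  have inj w u v : w <= u < w + n -> w <= v < w + n -> vx u = vx v -> u = v.
    move=> wu wv euv; case: (leqP u v) => uv; first by apply: (@vx_inj p) => //; lia.
    by apply/esym; apply: (@vx_inj p) => //; lia.
  have Rab' : R (a + n) (b + n) by rewrite (arc_per sysR).
  rewrite !inE -!orbA => /or3P[] /eqP ec; subst c.
  - case/or3P=> /eqP /(inj a) ey; case/or3P=> /eqP /(inj a) ed; lia.
  - rewrite -![vx a]vxD.
    case/or3P=> /eqP /(inj x) ey; case/or3P=> /eqP /(inj x) ed; try lia.
    by have := arc_lam sysR Rab Rcd; lia.
  - rewrite -![vx a]vxD -![vx x]vxD.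
    case/or3P=> /eqP /(inj b) ey; case/or3P=> /eqP /(inj b) ed; try lia.
    by have := arc_lam sysR Rcd Rab'; lia.
move=> ax cy etri.
have mc : vx c \in triangle a x b by rewrite etri !inE eqxx.
have my : vx y \in triangle a x b by rewrite etri !inE eqxx orbT.
have md : vx d \in triangle a x b by rewrite etri !inE eqxx orbT.
have [u ucases /vx_eq[q [ec|eu]]] :
    exists2 u, [|| u == a, u == x | u == b] & vx c = vx u.
  move: mc; rewrite !inE -orbA => /or3P[] /eqP ->;
  by [exists a; rewrite ?eqxx | exists x; rewrite ?eqxx ?orbT
     | exists b; rewrite ?eqxx ?orbT].
  have [|||-> ->] := core _ _ _ _ _ _ (apex_per sysR q ax) cy.
  - by rewrite ec !eqn_add2r.
  - by rewrite /triangle !vxDM.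
  - by rewrite /triangle !vxDM.
  - by rewrite dpairDM.
have [|||<- <-] := core _ _ _ _ _ _ ax (apex_per sysR q cy).
- by rewrite -eu.
- by rewrite vxDM.
- by rewrite vxDM.
- by rewrite dpairDM.
Qed.

(** Choose for each diagonal a side containing the triangle. The third vertex forces the choice at
    the sides of the triangle, behind for [a b] and in front for the other two, and [sub_triangle]
    bounds the intersection. *)
Lemma triangle_in_parts a b x : apex R a b x -> triangle a x b \in parts D.
Proof.
move=> ax; have [Rab axb ex mx] := ax; have gab := arc_gap sysR Rab.
pose E := [set d | triangle a x b \subset side true d].
have Eside d : d \in D -> triangle a x b \subset side (d \in E) d.
  case/diagonals_arc=> c [z [Rcz _ <-]]; rewrite inE.
  case: (boolP (_ \subset side true _)) => // /negP nE; move: (triangle_side ax Rcz) nE.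
  by case: (vx c < vx z) => /= -[] // -> [].
have Ebehind c z : R c z -> ~~ (triangle a x b \subset front c z) ->
    (dpair c z \in E) = (vx c < vx z).
  move=> Rcz; have := Eside _ (mem_diagonals sysR Rcz).
  by case: (_ \in E); case: (vx c < vx z) => // ->.
have Efront c z : R c z -> ~~ (triangle a x b \subset behind c z) ->
    (dpair c z \in E) = ~~ (vx c < vx z).
  move=> Rcz; have := Eside _ (mem_diagonals sysR Rcz).
  by case: (_ \in E); case: (vx c < vx z) => // ->.
rewrite inE card_triangle //; apply/existsP; exists E; apply/eqP.
apply/eqP; rewrite eqEsubset; apply/andP; split; first exact/bigcapsP.
apply: (sub_triangle ax) => [|Rax|Rxb].
- rewrite -Ebehind //; first by apply: bigcap_inf; apply: mem_diagonals.
  rewrite triangle_sub !side_front //; lia.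
- rewrite -Efront //; first by apply: bigcap_inf; apply: mem_diagonals.
  have gax := arc_gap sysR Rax.
  rewrite triangle_sub !side_behind //; lia.
- rewrite -Efront //; first by apply: bigcap_inf; apply: mem_diagonals.
  have gxb := arc_gap sysR Rxb.
  rewrite triangle_sub -[vx a]vxD !side_behind //; lia.
Qed.

Lemma triangle_fun a b x c d y : apex R a b x -> apex R c d y ->
  dpair a b = dpair c d -> triangle a x b = triangle c y d.
Proof.
move=> ax cy eqd; have [Rab _ _ _] := ax; have [Rcd _ _ _] := cy.
have [q [[ea eb]|[ec ed]]] := dpair_inj sysR Rab Rcd eqd.
  have := apex_per sysR q cy; rewrite -ea -eb => /(apex_fun ax) ex.
  by rewrite /triangle ea eb ex !vxDM.
have := apex_per sysR q ax; rewrite -ec -ed => /(apex_fun cy) ex.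
by rewrite /triangle ec ed ex !vxDM.
Qed.

Hypothesis S_gt2 : 2 < #|S|.

(** A part other than the uncovered set disagrees with [wrapped] at some diagonal, so it lies behind
    an arc. Descend to shorter arcs while it lies behind one of the inner sides of the triangle;
    then it is contained in that triangle, and having three vertices it equals it. *)
Lemma part_triangle A : A \in parts D -> A != S ->
  exists a b x, apex R a b x /\ A = triangle a x b.
Proof.
move=> Apart AS.
have [a [b [Rab Aab]]] : exists a b, R a b /\ A \subset behind a b.
  move: (Apart); rewrite inE => /andP[_ /existsP[E /eqP eA]].
  have : ~~ [forall d in D, (d \in E) == (d \in wrapped p R)].
    apply: contraNN AS => /forall_inP eE; rewrite eA cover_bigcap //.
    by apply/eqP; apply: eq_bigr => d /eE/eqP ->.
  case/forall_inPn => d dD; have [a [b [Rab _ ed]]] := diagonals_arc dD.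
  rewrite -ed mem_wrapped // => neq; exists a, b; split=> //.
  have : A \subset side (dpair a b \in E) (dpair a b).
    by rewrite eA ed; apply: bigcap_inf.
  by move: neq; case: (_ \in E); case: (vx a < vx b).
have [m] := ubnP (b - a); elim: m a b Rab Aab => // m IH a b Rab Aab lm.
have [x ax] := apex_exists sysR Rab; have [_ axb _ _] := ax.
have card_tri := card_triangle ax.
have descent c d : R c d -> d - c < b - a ->
    (exists a b x, apex R a b x /\ A = triangle a x b) \/ A \subset front c d.
  move=> Rcd lt; have [Acd|] := part_side Apart Rcd; last by right.
  by left; apply: IH Rcd Acd _; lia.
have A3 : 2 < #|A| by move: Apart; rewrite inE => /andP[].
have [done|Aax] : (exists a b x, apex R a b x /\ A = triangle a x b) \/
    (R a x -> A \subset front a x).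
  case Rax: (R a x); last by right.
  by have [|h|h] := descent _ _ Rax; [lia|left|right].
  by [].
have [done|Axb] : (exists a b x, apex R a b x /\ A = triangle a x b) \/
    (R x b -> A \subset front x b).
  case Rxb: (R x b); last by right.
  by have [|h|h] := descent _ _ Rxb; [lia|left|right].
  by [].
exists a, b, x; split=> //; apply/eqP; rewrite eqEcard card_tri A3 andbT.
exact: sub_triangle.
Qed.

Lemma triangle_neq a b x : apex R a b x -> triangle a x b != S.
Proof.
case=> Rab axb _ _; apply/eqP => /setP/(_ (vx x)).
by rewrite in_setC (cover_avoids sysR Rab axb) !inE eqxx orbT.
Qed.

Lemma card_parts_minus : #|parts D :\ S| = #|D|.
Proof.
have : forall d, exists A, d \in D -> exists a b x,
    [/\ apex R a b x, dpair a b = d & A = triangle a x b].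
  move=> d; case: (boolP (d \in D)) => [/diagonals_arc|_]; last by exists set0.
  case=> a [b [Rab _ ed]]; have [x ax] := apex_exists sysR Rab.
  by exists (triangle a x b) => _; exists a, b, x.
case/fin_all_exists => f fP.
have finj : {in D &, injective f}.
  move=> d e /fP[a [b [x [ax <- ->]]]] /fP[c [z [y [cy <- ->]]]].
  exact: triangle_inj.
rewrite -(card_in_imset finj); congr #|pred_of_set _|; apply/setP => A.
apply/idP/imsetP.
  rewrite in_setD1 => /andP[AS /part_triangle/(_ AS)[a [b [x [ax ->]]]]].
  have [Rab _ _ _] := ax; have dD := mem_diagonals sysR Rab.
  exists (dpair a b) => //; have [c [d [y [cy e ->]]]] := fP _ dD.
  exact: triangle_fun.
case=> d /fP[a [b [x [ax _ ->]]]] ->.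
by rewrite in_setD1 triangle_neq // triangle_in_parts.
Qed.

Lemma perm_parts :
  perm_eq [seq #|A| | A : {set 'I_n} in parts D] (#|S| :: nseq #|D| 3).
Proof.
have p1 : perm_eq (enum (parts D)) (S :: enum (parts D :\ S)).
  apply: uniq_perm; rewrite /= ?enum_uniq ?andbT //.
    by rewrite mem_enum in_setD1 eqxx.
  move=> A; rewrite in_cons !mem_enum in_setD1.
  have [->|//] := eqVneq; exact: cover_in_parts.
apply: perm_trans (perm_map _ p1) _; rewrite /= perm_cons.
suff /all_pred1P -> : all (pred1 3) [seq #|A| | A : {set 'I_n} <- enum (parts D :\ S)].
  by rewrite size_map -cardE card_parts_minus.
apply/allP => c /mapP[A]; rewrite mem_enum in_setD1 => /andP[AS AD] ->.
have [a [b [x [ax ->]]]] := part_triangle AD AS.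
by rewrite /= card_triangle.
Qed.

End Triangles.

Lemma eq_walk_arc g h : g =1 h -> walk_arc g =2 walk_arc h.
Proof.
move=> gh a b; rewrite /walk_arc.
have e i : psum g i = psum h i by apply: eq_bigr => j _; apply: gh.
by rewrite !e; congr [&& _, _ & _]; apply: eq_all => c; rewrite !e.
Qed.

Lemma eq_diagonals p R R' : R =2 R' -> diagonals p R = diagonals p R'.
Proof. by move=> eR; apply/setP => d; rewrite !inE !eR. Qed.

Lemma eq_cover p R R' : R =2 R' -> cover p R = cover p R'.
Proof.
move=> eR; apply/setP => v; rewrite !inE.
by apply: eq_existsb => a; apply: eq_existsb => b; rewrite eR.
Qed.

(** * Counting *)

Section Count.

Variables p k : nat.
Local Notation n := p.+1.
Local Notation m := (n - k).
Hypotheses (k_gt2 : 2 < k) (k_le : k <= n).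

(** Nothing is asked of the other parts: the number of diagonals equals that of the vertices outside
    the marked part, which forces them to be triangles. *)
Definition marked : {set {set 'I_n * 'I_n} * {set 'I_n}} :=
  [set DS | [&& is_dissection m DS.1, DS.2 \in parts DS.1 & #|DS.2| == k]].

(** Entries with sum [m] are at most [m], so the bounded type loses no sequence; this is the form
    counted by [card_ord_partitions]. *)
Definition degrees : {set n.-tuple 'I_m.+1} := 
  [set t : n.-tuple 'I_m.+1 | \sum_(i <- t) i == m].

Definition degree (t : n.-tuple 'I_m.+1) (a : nat) : nat := tnth t (vx p a).

Definition marked_of (t : n.-tuple 'I_m.+1) :=
  (diagonals p (walk_arc (degree t)), ~: cover p (walk_arc (degree t))).

Lemma degree_per t i : degree t (i + n) = degree t i.
Proof. by rewrite /degree vxD. Qed.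

Lemma sum_degree t : t \in degrees -> \sum_(0 <= i < n) degree t i + k = n.
Proof.
rewrite inE big_tuple => /eqP st; rewrite big_mkord -[n in RHS](subnK k_le).
by congr (_ + k); rewrite -[RHS]st; apply: eq_bigr => i _; rewrite /degree vx_ord.
Qed.

Lemma marked_dissection D S : (D, S) \in marked ->
  [/\ forall d, d \in D -> is_diagonal d,
      forall d e, d \in D -> e \in D -> ~~ crossing d e,
      S \in parts D, #|D| = m & #|S| = k].
Proof.
rewrite inE => /and3P[/= /and3P[/eqP cD /forall_inP dD nD] SD /eqP cS].
split=> // d e dInD eInD.
by have /forall_inP/(_ _ dInD)/forall_inP/(_ _ eInD) := nD.
Qed.

Lemma marked_arcs D S (R := arcs D S) : (D, S) \in marked ->
  [/\ arc_system n R, perfect n R, diagonals p R = D, ~: cover p R = S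
    & \sum_(0 <= i < n) outdeg n R i = m].
Proof.
case/marked_dissection => dD nD SD cD cS.
have sysR : arc_system n R := arcs_system nD SD.
have eD : diagonals p R = D := diagonals_arcs dD SD.
have eS : ~: cover p R = S := cover_arcs dD nD SD.
split=> //; last by rewrite sum_outdeg // eD.
apply: perfect_card => //; rewrite eD cD.
have := cardsC (cover p R); rewrite eS cS card_ord; lia.
Qed.

(** The out-degrees sum to [m], which counts the diagonals; perfection gives as many covered
    vertices, leaving [k] uncovered ones. *)
Lemma marked_of_arcs t : t \in degrees ->
  [/\ arc_system n (walk_arc (degree t)), perfect n (walk_arc (degree t)),
      #|(marked_of t).1| = m & #|(marked_of t).2| = k].
Proof.
move=> st; have sum_t := sum_degree st; have per := degree_per t.
have sysR := walk_arc_system per k_gt2 sum_t.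
have perfR := walk_arc_perfect per k_gt2 sum_t.
have cD : #|(marked_of t).1| = m.
  rewrite /= -sum_outdeg // (eq_bigr (degree t)) => [|i _]; first lia.
  exact: outdeg_walk_arc per k_gt2 sum_t _.
split=> //=; have := cardsC (cover p (walk_arc (degree t))).
have := card_diagonals_le sysR; have := card_cover_le sysR perfR.
by rewrite card_ord; move: cD => /=; lia.
Qed.

Lemma marked_of_mem t : t \in degrees -> marked_of t \in marked.
Proof.
move=> st; have [sysR perfR cD cS] := marked_of_arcs st.
rewrite inE cS eqxx andbT cover_in_parts ?cS // andbT /is_dissection cD eqxx /=.
have S3 : 2 < #|(marked_of t).2| by rewrite cS.
apply/andP; split; apply/forall_inP => d dD.
  exact: diagonals_is_diagonal dD.
by apply/forall_inP => e eD; apply: diagonals_noncrossing dD eD.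
Qed.

(** Orienting the diagonals away from the uncovered set restores the walk arcs, so the degrees can
    be read off the marked dissection. *)
Lemma arcs_marked_of t : t \in degrees ->
  arcs (marked_of t).1 (marked_of t).2 =2 walk_arc (degree t).
Proof.
move=> st; have [sysR perfR cD cS] := marked_of_arcs st.
have [sysA _ _ _ _] := marked_arcs (marked_of_mem st).
have sub a b : walk_arc (degree t) a b -> arcs (marked_of t).1 (marked_of t).2 a b.
  move=> Rab; have gab := arc_gap sysR Rab; have /andP[ab ban] := gab.
  rewrite /arcs ab ban mem_diagonals //=; apply/subsetP => v.
  have [c ac <-] := vx_surj a v; rewrite in_setC side_front //.
  apply: contraNT; rewrite negb_or => /andP[ca cb].
  by apply: (cover_avoids sysR Rab); lia.
move=> a b; apply/idP/idP => [Aab|]; last exact: sub.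
have /and4P[_ _ /diagonals_arc[c [d [Rcd _ ecd]]] _] := Aab.
have [q [[ec ed]|[ea eb]]] := dpair_inj sysA (sub _ _ Rcd) Aab ecd.
  by rewrite -(arc_perM sysR q) -ec -ed.
by rewrite ea eb arc_perM.
Qed.

Lemma marked_of_inj : {in degrees &, injective marked_of}.
Proof.
move=> t u st su etu; apply/eq_from_tnth => i; apply/val_inj => /=.
have eR : walk_arc (degree t) =2 walk_arc (degree u).
  by move=> a b; rewrite -!arcs_marked_of // etu.
have := outdeg_walk_arc (degree_per u) k_gt2 (sum_degree su) i.
rewrite /degree vx_ord => <-.
have := outdeg_walk_arc (degree_per t) k_gt2 (sum_degree st) i.
rewrite {2}/degree vx_ord => <-.
by apply: eq_bigr => b _; rewrite eR.
Qed.

Lemma marked_of_surj D S : (D, S) \in marked ->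
  exists2 t, t \in degrees & marked_of t = (D, S).
Proof.
move=> DS; have [sysR perfR eD eS sumR] := marked_arcs DS.
set R := arcs D S in sysR perfR eD eS sumR.
have le_m (i : 'I_n) : outdeg n R i < m.+1.
  by rewrite ltnS -sumR big_mkord (bigD1 i) //= leq_addr.
pose t := [tuple Ordinal (le_m i) | i < n].
have et a : degree t a = outdeg n R a.
  rewrite /degree tnth_mktuple; change (outdeg n R (vx p a) = outdeg n R a).
  have [q [r [rn ->]]] := base_shift p a.
  rewrite vxDM; have [er _] := val_vx p r; rewrite er //.
  by elim: q => [|q IH]; rewrite ?addn0 // mulSnr addnA outdeg_per.
have eW : walk_arc (degree t) =2 R.
  move=> a b; rewrite (eq_walk_arc et); apply: (walk_arc_outdeg (k := k)) => //.
  by rewrite sumR subnK.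
exists t; last by rewrite /marked_of (eq_diagonals p eW) (eq_cover p eW) eD eS.
rewrite inE big_tuple -[X in _ == X]sumR big_mkord; apply/eqP/eq_bigr => i _.
by rewrite -et /degree vx_ord.
Qed.

Lemma card_marked : #|marked| = 'C(p + m, p).
Proof.
rewrite -card_ord_partitions -/degrees -(card_in_imset marked_of_inj).
congr #|pred_of_set _|; apply/setP => -[D S]; apply/idP/imsetP.
  by case/marked_of_surj => t st <-; exists t.
by case=> t st ->; apply: marked_of_mem.
Qed.

(** For [k > 3] the marked part is determined by the diagonals, since every other part is a
    triangle. *)
Lemma card_k_in_n : 3 < k ->
  #|[set D : {set 'I_n * 'I_n} | is_k_in_n k D]| = #|marked|.
Proof.
move=> k_gt3.
have inj : {in marked &, injective fst}.
  move=> [D S] [D' S'] DS DS' /= eD; subst D'; congr (_, _).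
  have [sysR perfR eD eS _] := marked_arcs DS.
  have [_ _ _ _ cS] := marked_dissection DS.
  have [_ _ S'D _ cS'] := marked_dissection DS'.
  apply/eqP; rewrite eq_sym; apply/negPn/negP => neq.
  have S3 : 2 < #|~: cover p (arcs D S)| by rewrite eS cS.
  rewrite -eD in S'D; rewrite -eS in neq.
  have [a [b [x [ax eS']]]] := part_triangle sysR perfR S3 S'D neq.
  by move: cS'; rewrite eS' (card_triangle sysR ax) => e; rewrite -e in k_gt3.
rewrite -(card_in_imset inj); congr #|pred_of_set _|; apply/setP => D.
rewrite inE; apply/andP/imsetP => [[dis sizes]|[[D' S] DS ->]].
  have : k \in [seq #|A| | A : {set 'I_n} in parts D].
    by rewrite (perm_mem sizes) mem_head.
  case/mapP => S; rewrite mem_enum => SD eS.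
  by exists (D, S); rewrite // inE /= dis SD -eS eqxx.
have [sysR perfR eD eS _] := marked_arcs DS.
have [_ _ _ cD cS] := marked_dissection DS.
split; first by move: DS; rewrite inE => /and3P[].
have S3 : 2 < #|~: cover p (arcs D' S)| by rewrite eS cS.
by have := perm_parts sysR perfR S3; rewrite eD eS cD cS.
Qed.

End Count.

Theorem theorem5 (n k : nat) (hk : 3 <= k) (hkn : k <= n) :
  num_k_in_n k n = 'C(2 * n - k - 1, n - 1).
Proof.
case: n hkn => [|p] hkn; first by rewrite leqn0 in hkn; rewrite (eqP hkn) in hk.
have -> : 2 * p.+1 - k - 1 = p + (p.+1 - k) by lia.
rewrite subn1 -card_marked // /num_k_in_n.
(* For [k = 3] the marked dissections are triangulations with a marked triangle by definition. *)
case: eqP => [k3|/eqP k3]; last by apply: card_k_in_n => //; lia.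
by subst k; congr #|pred_of_set _|; apply/setP => -[D T]; rewrite !inE.
Qed.
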